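(* Every graph $H$ is the $\Gamma$-graph of infinitely many graphs; that is, for every graph $H$ there exist infinitely many graphs $G$ whose $\Gamma$-graph is isomorphic to $H$.
   Context: For a graph $G$, a dominating set $S$ is minimal dominating if no proper subset of $S$ is dominating. The upper domination number $\Gamma(G)$ is the maximum cardinality of a minimal dominating set, and a $\Gamma$-set is a minimal dominating set of cardinality $\Gamma(G)$. The $\Gamma$-graph of $G$ has one vertex for each $\Gamma$-set of $G$, and the vertices corresponding to $S_u,S_w$ are adjacent iff there exist $u'\in S_u$, $w'\in S_w$ with $u'w'\in E(G)$ and $S_w=(S_u-\{u'\})\cup\{w'\}$. *)

(* Defs.v *)
Set Warnings "-notation-overridden".
From mathcomp Require Import all_boot.

Set Implicit Arguments.
Unset Strict Implicit.
Unset Printing Implicit Defensive.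

(* Finite simple graphs. As usual in domination theory the vertex set is
   nonempty: every graph has a minimal dominating set, so the graph without
   vertices is not a Gamma-graph. *)
Record graph := Graph {
  vertex :> finType;
  adj : rel vertex;
  adj_sym : symmetric adj;
  adj_irr : irreflexive adj;
  vertex_nonempty : 0 < #|vertex|
}.

Definition graph_iso (G H : graph) : Prop :=
  exists2 f : G -> H, bijective f & forall x y, adj (f x) (f y) = adj x y.

Section Domination.
Variable G : graph.
Implicit Types S T : {set G}.

Definition dominating S : bool :=
  [forall x, (x \notin S) ==> [exists y in S, adj x y]].

Definition minimal_dominating S : bool := minset dominating S.

Definition upper_domination : nat := \max_(S | minimal_dominating S) #|S|.

Definition Gamma_set S : bool :=
  minimal_dominating S && (#|S| == upper_domination).

Definition slide S T : bool :=
  [exists u in S, exists w in T, adj u w && (T == w |: (S :\ u))].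

Definition Gamma_vertex : finType := {S : {set G} | Gamma_set S}.

Definition Gamma_adj : rel Gamma_vertex := fun X Y => slide (sval X) (sval Y).

Lemma slide_sym S T : #|S| = #|T| -> slide S T -> slide T S.
Proof.
move=> cST /exists_inP[u uS /exists_inP[w wT /andP[uw /eqP defT]]].
apply/exists_inP; exists w => //; apply/exists_inP; exists u => //.
rewrite adj_sym uw /=; apply/eqP.
have wS : w \notin S :\ u.
  apply/negP=> wSu; have defT' : T = S :\ u.
    by rewrite defT; apply/setUidPr; rewrite sub1set.
  by move: cST; rewrite defT' (cardsD1 u S) uS => /eqP; rewrite -[X in _ == X]add0n eqn_add2r.
by rewrite defT setU1K // setD1K.
Qed.

Lemma Gamma_adj_sym : symmetric Gamma_adj.
Proof.
move=> [S gS] [T gT]; rewrite /Gamma_adj /=.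
have /andP[_ /eqP cS] := gS; have /andP[_ /eqP cT] := gT.
by apply/idP/idP; apply: slide_sym; rewrite cS cT.
Qed.

Lemma slide_irr S : slide S S = false.
Proof.
apply/exists_inP=> -[u uS /exists_inP[w _ /andP[uw /eqP defS]]].
move: uS; rewrite defS !inE eqxx orbF => /eqP eq_uw.
by move: uw; rewrite eq_uw adj_irr.
Qed.

Lemma Gamma_adj_irr : irreflexive Gamma_adj.
Proof. by move=> X; apply: slide_irr. Qed.

Lemma Gamma_vertex_nonempty : 0 < #|Gamma_vertex|.
Proof.
have domT : dominating setT by apply/forallP=> x; rewrite inE.
have [S minS _] := minset_exists domT.
have ex : 0 < #|[pred S | minimal_dominating S]| by apply/card_gt0P; exists S.
have [T mT cT] := eq_bigmax_cond (fun S : {set G} => #|S|) ex.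
have gT : Gamma_set T.
  by rewrite /Gamma_set /upper_domination; apply/andP; split=> //; rewrite -cT.
by apply/card_gt0P; exists (exist _ T gT).
Qed.

Definition Gamma_graph : graph :=
  Graph Gamma_adj_sym Gamma_adj_irr Gamma_vertex_nonempty.

End Domination.

(* Main.v *)
(** Let [k > |H|]. Add to [H] two cliques [c_0, ..., c_k] and [y_0, ..., y_k];
    join every [c_i] to all of [H], join [c_i] to [y_i] for [i > 0], and join
    [y_0] to all of [H].
    A dominating set that avoids the [y_i] must contain [c_1, ..., c_k], to
    dominate [y_1, ..., y_k], and a vertex [v] of [H], to dominate [y_0]; since
    [{v, c_1, ..., c_k}] is already dominating, a minimal one is of this form.
    In a minimal dominating set containing some [y_i], either another vertex
    forms with some [y_j] a dominating pair, or all other vertices lie in [H];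
    so it has at most [|H| + 1 < k + 1] vertices. Hence the Gamma-sets are the
    sets [{v, c_1, ..., c_k}], and a slide between two of them is an edge of [H].
    Every [k > |H|] gives such a graph. *)
Require Import Defs.
From mathcomp Require Import all_boot.

Set Implicit Arguments.
Unset Strict Implicit.
Unset Printing Implicit Defensive.

(** With closed neighbourhoods, members of [S] need no separate case. *)
Lemma dominatingP (G : graph) (S : {set G}) :
  reflect (forall x, exists2 y, y \in S & (x == y) || adj x y) (dominating S).
Proof.
apply: (iffP forallP) => [domS x | domS x].
  have [xS | xS] := boolP (x \in S); first by exists x; rewrite ?eqxx.
  have /exists_inP[y yS xy] := implyP (domS x) xS.
  by exists y; rewrite ?xy ?orbT.
apply/implyP=> xS; have [y yS /orP[/eqP xy | xy]] := domS x.
  by rewrite xy yS in xS.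
by apply/exists_inP; exists y.
Qed.

Section Construction.
Variables (H : graph) (k : nat).
Hypothesis ltHk : #|H| < k.

(* The vertices [c_0] and [y_0] are the two [None]s. *)
Definition ext_vertex : finType := (H + option 'I_k + option 'I_k)%type.

Definition hv (h : H) : ext_vertex := inl (inl h).
Definition cv (i : option 'I_k) : ext_vertex := inl (inr i).
Definition yv (i : option 'I_k) : ext_vertex := inr i.

(** The test [i != None] denies [c_0] any neighbour among the [y_j], so that a dominating set
    without any [c_j] must meet [H]. *)
Definition ext_adj : rel ext_vertex := fun x y =>
  match x, y with
  | inl (inl g), inl (inl h) => adj g h
  | inl (inl _), inl (inr _) | inl (inr _), inl (inl _) => true
  | inl (inl _), inr i | inr i, inl (inl _) => i == None
  | inl (inr i), inr j | inr j, inl (inr i) => (i == j) && (i != None)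
  | inl (inr i), inl (inr j) | inr i, inr j => i != j
  end.

Lemma ext_adj_sym : symmetric ext_adj.
Proof.
by move=> [[g|i]|i] [[h|j]|j] //=; [apply: adj_sym | rewrite eq_sym..].
Qed.

Lemma ext_adj_irr : irreflexive ext_adj.
Proof. by move=> [[g|i]|i] /=; rewrite ?adj_irr ?eqxx. Qed.

Lemma ext_vertex_nonempty : 0 < #|ext_vertex|.
Proof. by apply/card_gt0P; exists (yv None). Qed.

Definition ext_graph : graph :=
  Graph ext_adj_sym ext_adj_irr ext_vertex_nonempty.

Lemma card_ext_graph : #|ext_graph| = #|H| + k.+1 + k.+1.
Proof. by rewrite !card_sum card_option card_ord. Qed.

(** * The intended Gamma-sets *)

Definition ext_set (v : H) : {set ext_graph} :=
  hv v |: [set cv (Some i) | i : 'I_k].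

Lemma hv_ext_set v h : (hv h \in ext_set v) = (h == v).
Proof.
rewrite !inE; have -> : (hv h == hv v) = (h == v) by [].
by case: imsetP => [[]//|_]; rewrite orbF.
Qed.

Lemma cv_ext_set v i : cv (Some i) \in ext_set v.
Proof. by apply/setU1P; right; apply/imsetP; exists i. Qed.

Lemma yv_ext_set v i : yv i \notin ext_set v.
Proof. by rewrite !inE; case: imsetP => [[]|]. Qed.

Lemma ext_set_inj : injective ext_set.
Proof. by move=> v w e; apply/eqP; rewrite -hv_ext_set -e hv_ext_set. Qed.

Lemma card_ext_set v : #|ext_set v| = k.+1.
Proof.
rewrite cardsU1 card_imset ?card_ord; last by move=> i j [].
by case: imsetP => [[]|].
Qed.

Lemma dominating_ext_set v : dominating (ext_set v).
Proof.
(* Some [cv (Some i)] is needed to dominate [H] and [c_0]; it exists because [k > 0]. *)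
have i0 : 'I_k by exists 0; apply: leq_ltn_trans ltHk.
apply/dominatingP=> -[[h|[i|]]|[i|]].
- by exists (cv (Some i0)); rewrite ?cv_ext_set ?orbT.
- by exists (cv (Some i)); rewrite ?cv_ext_set ?eqxx.
- by exists (cv (Some i0)); rewrite ?cv_ext_set.
- by exists (cv (Some i)); rewrite ?cv_ext_set //= eqxx.
- by exists (hv v); rewrite ?hv_ext_set ?eqxx.
Qed.

Lemma ext_set_sub (S : {set ext_graph}) :
    dominating S -> (forall i, yv i \notin S) -> exists v, ext_set v \subset S.
Proof.
move=> /dominatingP domS yS.
have [v vS] : exists v, hv v \in S.
  have [[[v|i]|i] xS //= e] := domS (yv None); first by exists v.
    by case: i e {xS}.
  by case/negP: (yS i).
exists v; apply/subsetP=> x; rewrite !inE => /predU1P[-> // | /imsetP[i _ ->]].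
have [[[h|j]|j] xS //= e] := domS (yv (Some i)); last by case/negP: (yS j).
by case/andP: e xS => /eqP->.
Qed.

(** A dominating subset still avoids every [y_i], so it contains some [ext_set w]; as [v] is the
    only vertex of [H] available, [w = v]. *)
Lemma minimal_dominating_ext_set v : minimal_dominating (ext_set v).
Proof.
apply/minsetP; split=> [|B domB sBv]; first exact: dominating_ext_set.
have yB i : yv i \notin B.
  by apply: contra (yv_ext_set v i); apply: (subsetP sBv).
have [w swB] := ext_set_sub domB yB.
have /eqP e : w == v.
  by rewrite -hv_ext_set (subsetP (subset_trans swB sBv)) // hv_ext_set.
by apply/eqP; rewrite eqEsubset sBv -e.
Qed.

(** * Minimal dominating sets containing some [y_i] *)

Lemma cv_clique i j : (cv i == cv j) || ext_adj (cv i) (cv j).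
Proof. by have [->|ne] := eqVneq i j; rewrite ?eqxx //= ne orbT. Qed.

Lemma yv_clique i j : (yv i == yv j) || ext_adj (yv i) (yv j).
Proof. by have [->|ne] := eqVneq i j; rewrite ?eqxx //= ne orbT. Qed.

Lemma dominating_cv_yv i j : dominating ([set cv i; yv j] : {set ext_graph}).
Proof.
apply/dominatingP=> -[[h|l]|l].
- by exists (cv i); rewrite ?set21 ?orbT.
- by exists (cv i); rewrite ?set21 ?cv_clique.
- by exists (yv j); rewrite ?set22 ?yv_clique.
Qed.

Lemma dominating_hv_yv v : dominating ([set hv v; yv None] : {set ext_graph}).
Proof.
apply/dominatingP=> -[[h|l]|l].
- by exists (yv None); rewrite ?set22.
- by exists (hv v); rewrite ?set21.
- by exists (yv None); rewrite ?set22 ?yv_clique.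
Qed.

Lemma card_minimal_dominating_yv (S : {set ext_graph}) i :
  minimal_dominating S -> yv i \in S -> #|S| <= #|H|.+1.
Proof.
move=> /minsetP[domS minS] iS.
(* By minimality a dominating pair inside [S] is all of [S], and [2 <= #|H| + 1] because [H] is
   nonempty. *)
have pairS (x y : ext_graph) :
    dominating [set x; y] -> x \in S -> y \in S -> #|S| <= #|H|.+1.
  move=> domxy xS yS; rewrite -(minS _ domxy) ?subUset ?sub1set ?xS //.
  by rewrite cards2 ltnS (leq_trans (leq_b1 _)) ?vertex_nonempty.
case: (pickP (fun j => cv j \in S)) => [j jS | noC].
  exact: pairS (dominating_cv_yv j i) jS iS.
have [v vS] : exists v, hv v \in S.
  have [[[v|j]|j] xS //= e] := dominatingP _ domS (cv None); first by exists v.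
    by have := noC j; rewrite /= xS.
  by rewrite andbF in e.
have [y0S | y0S] := boolP (yv None \in S).
  exact: pairS (dominating_hv_yv v) vS y0S.
(* Since [S] misses [y_0] and all [c_j], it dominates [H] from within [H]. So [T] dominates [H],
   while [v] takes care of the [c_j] and [y_i] of the [y_j]; minimality then gives [S = T]. *)
pose T : {set ext_graph} := yv i |: [set hv h | h in [set h | hv h \in S]].
have hT h : hv h \in S -> hv h \in T.
  by move=> hS; rewrite setU1r // imset_f // inE.
have domT : dominating T.
  apply/dominatingP=> -[[h|l]|l].
  - have [[[g|j]|j] xS e] := dominatingP _ domS (hv h).
    + by exists (hv g); rewrite ?hT.
    + by have := noC j; rewrite /= xS.
    + by case/negP: y0S; rewrite -(eqP (e : j == None)).
  - by exists (hv v); rewrite ?hT.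
  - by exists (yv i); rewrite ?setU11 ?yv_clique.
have sTS : T \subset S.
  by apply/subsetP=> x /setU1P[-> // | /imsetP[h]]; rewrite inE => hS ->.
rewrite -(minS T domT sTS) cardsU1 -add1n leq_add ?leq_b1 //.
exact: leq_trans (leq_imset_card _ _) (max_card _).
Qed.

Lemma minimal_dominating_ext (S : {set ext_graph}) :
  minimal_dominating S -> (exists v, S = ext_set v) \/ #|S| <= #|H|.+1.
Proof.
move=> minS; case: (pickP (fun i => yv i \in S)) => [i iS | noY].
  by right; apply: card_minimal_dominating_yv minS iS.
have /minsetP[domS mS] := minS.
have [i|v svS] := ext_set_sub domS; first by rewrite noY.
by left; exists v; rewrite (mS _ (dominating_ext_set v) svS).
Qed.

(** * The Gamma-graph *)

Lemma upper_domination_ext : upper_domination ext_graph = k.+1.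
Proof.
apply/eqP; rewrite eqn_leq; apply/andP; split.
  apply/bigmax_leqP=> S /minimal_dominating_ext[[v ->]|leS].
    by rewrite card_ext_set.
  exact: leq_trans leS (ltnW _).
have /card_gt0P[v _] := vertex_nonempty H.
by rewrite -(card_ext_set v); apply: leq_bigmax_cond (minimal_dominating_ext_set v).
Qed.

Lemma Gamma_set_ext (S : {set ext_graph}) :
  reflect (exists v, S = ext_set v) (Gamma_set S).
Proof.
rewrite /Gamma_set upper_domination_ext.
apply: (iffP andP) => [[/minimal_dominating_ext[//|leS] /eqP cS]|[v ->]].
  by move: leS; rewrite cS ltnS leqNgt ltHk.
by rewrite minimal_dominating_ext_set card_ext_set.
Qed.

Lemma slide_ext_set v w : slide (ext_set v) (ext_set w) = adj v w.
Proof.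
have [->|neq_vw] := eqVneq v w; first by rewrite slide_irr adj_irr.
apply/exists_inP/idP => [[x xS /exists_inP[y yT /andP[xy /eqP defT]]]|vw].
  (* Passing from [ext_set v] to [ext_set w] loses [hv v] and gains [hv w], which determines both
     ends of the slide. *)
  have ex : x = hv v.
    have := hv_ext_set w v; rewrite (negPf neq_vw) defT in_setU1 in_setD1.
    rewrite hv_ext_set eqxx andbT => /norP[_ /negbNE/eqP //].
  have ey : y = hv w.
    have := hv_ext_set w w; rewrite eqxx defT in_setU1 in_setD1 hv_ext_set.
    by rewrite [w == v]eq_sym (negPf neq_vw) andbF orbF => /eqP.
  by rewrite ex ey in xy.
exists (hv v); first by rewrite hv_ext_set.
apply/exists_inP; exists (hv w); first by rewrite hv_ext_set.
apply/andP; split=> //; rewrite /ext_set setU1K //.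
by case: imsetP => [[]|].
Qed.

Lemma Gamma_graph_ext : graph_iso (Gamma_graph ext_graph) H.
Proof.
have exv (X : Gamma_graph ext_graph) : exists v, sval X == ext_set v.
  by have /Gamma_set_ext[v e] := svalP X; exists v; apply/eqP.
pose f X := xchoose (exv X).
have fE X : sval X = ext_set (f X) := eqP (xchooseP (exv X)).
exists f => [|X Y]; last by rewrite -slide_ext_set -!fE.
have gP v : Gamma_set (ext_set v) by apply/Gamma_set_ext; exists v.
pose g v : Gamma_graph ext_graph := exist _ (ext_set v) (gP v).
exists g => [X | v]; first by apply: val_inj; rewrite /= -fE.
by apply: ext_set_inj; rewrite -fE.
Qed.

End Construction.

Theorem theorem9 (H : graph) :
  exists G : nat -> graph,
    (forall m n, graph_iso (G m) (G n) -> m = n) /\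
    (forall n, graph_iso (Gamma_graph (G n)) H).
Proof.
(* The shift by [#|H| + 1] makes [k > #|H|] for every [n]; the order [#|H| + 2 (k + 1)] tells the
   graphs apart. *)
exists (fun n => ext_graph H (n + #|H|.+1)); split=> [m n [f bij_f _]|n].
  have := bij_eq_card bij_f; rewrite !card_ext_graph -!addnA => /addnI.
  by rewrite !addnn => /double_inj[] /addIn.
by apply: Gamma_graph_ext; rewrite leq_addl.
Qed.
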